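(* Let $(S_t)_{0\le t\le T}$ be the price process of a financial market on a Dedekind complete Riesz space $E$ with filtration $(\mathbb{F}_t)_{0\le t\le T}$. The AIP (absence of immediate profit) condition holds if and only if, for all $0\leq t<T$, $$m_{\mathbb{F}_{t}}(S_{t+1})\leq S_{t}\leq M_{\mathbb{F}_{t}}(S_{t+1}).$$
   Context: $E$ is a Dedekind complete Riesz space with weak order unit $e$; $E^{u}$ is its universal completion, an $f$-algebra with unit $e$, in which products are taken. A conditional expectation on $E$ is a strictly positive order continuous linear projection $\mathbb{F}$ with $\mathbb{F}e=e$ whose range is a Dedekind complete Riesz subspace. It extends uniquely to a conditional expectation, still denoted $\mathbb{F}$, on its natural domain $\mathcal{L}^{1}(\mathbb{F})$, the largest Riesz subspace of $E^{u}$ to which $\mathbb{F}$ so extends (its positive elements are those $z\in E^{u}_{+}$ for which there is a net $0\le x_\alpha\uparrow z$ in $E$ with $(\mathbb{F}x_\alpha)$ order bounded in $E^{u}$, and then $\mathbb{F}z=\sup_\alpha\mathbb{F}x_\alpha$). $R(\mathbb{F})$ is the range of this extension (a universally complete $f$-subalgebra of $E^{u}$); $R(\mathbb{F})^{+}$ and $R(\mathbb{F})^{-}$ are its sets of elements $\geq 0$ and $\leq 0$. $\mathcal{L}^{\infty}(\mathbb{F})$ is the ideal of $E^{u}$ generated by $R(\mathbb{F})$; for $f\in\mathcal{L}^{\infty}(\mathbb{F})$, $M_{\mathbb{F}}(f)=\inf\{g\in R(\mathbb{F}): f\leq g\}$ and $m_{\mathbb{F}}(f)=\sup\{g\in R(\mathbb{F}):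 g\leq f\}$. Financial market: $T\geq 1$ is an integer horizon, times are $0,1,\dots,T$, and $(\mathbb{F}_t)_{0\le t\le T}$ is a filtration, i.e. a family of conditional expectations on $E$ with $\mathbb{F}_i\mathbb{F}_j=\mathbb{F}_j\mathbb{F}_i=\mathbb{F}_i$ for $i<j$ (so $R(\mathbb{F}_i)\subset R(\mathbb{F}_j)$). The price process satisfies $S_t\in R(\mathbb{F}_t)$, $S_t\geq 0$, and $S_{t+1}\in\mathcal{L}^{\infty}(\mathbb{F}_t)$ for $0\le t<T$. Put $\Delta S_i=S_i-S_{i-1}$. The set of terminal portfolio values started at time $t$ from zero capital is $$\mathcal{V}_{t,T}=\Big\{\sum_{i=t+1}^{T}\theta_{i-1}\Delta S_i:\ \theta_i\in R(\mathbb{F}_i)\Big\}.$$ The set of super-hedging prices at time $t$ of the zero claim is $P_{t,T}=\{p_t\in R(\mathbb{F}_t):\exists\, v\in\mathcal{V}_{t,T},\ p_t+v\geq 0\}$. AIP means $P_{t,T}\cap R(\mathbb{F}_t)^{-}=\{0\}$ for all $t<T$. *)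

(* Defs.v *)
From HB Require Import structures.
From mathcomp Require Import all_boot all_order all_algebra.
From mathcomp Require Import boolp classical_sets reals.

Set Implicit Arguments.
Unset Strict Implicit.
Unset Printing Implicit Defensive.

Import Order.TTheory GRing.Theory Num.Theory.

Local Open Scope classical_set_scope.
Local Open Scope ring_scope.

(* The classes [Num.RealDomain] and [Num.NumDomain] already join lattices and
   rings with [ring_display] orders, without intermediate structures that Riesz
   spaces and f-algebras could inherit from; hence the lattice operations
   (given by their universal properties) and the product are fields here. *)
HB.mixin Record isRieszSpace (R : realType) E
    of Num.POrderedZmodule E & GRing.Lmodule R E := {
  rjoin : E -> E -> E;
  rmeet : E -> E -> E;
  rjoin_le : forall x y z : E, (rjoin x y <= z) = (x <= z) && (y <= z);
  le_rmeet : forall x y z : E, (z <= rmeet x y) = (z <= x) && (z <= y);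
  riesz_leD2r : forall z x y : E, x <= y -> x + z <= y + z;
  riesz_scale_ge0 : forall (a : R) (x : E), 0 <= a -> 0 <= x -> 0 <= a *: x
}.

#[short(type="rieszType")]
HB.structure Definition RieszSpace (R : realType) :=
  { E of isRieszSpace R E & Num.POrderedZmodule E & GRing.Lmodule R E }.

(* Unital f-algebras. Commutativity is part of the structure: it holds in every
   Archimedean f-algebra. Nontriviality is not required. *)
HB.mixin Record RieszSpace_isFAlgebra (R : realType) U of RieszSpace R U := {
  fone : U;
  fmul : U -> U -> U;
  fmulA : associative fmul;
  fmulC : commutative fmul;
  fmul1 : left_id fone fmul;
  fmulDl : left_distributive fmul +%R;
  fmulZl : forall (a : R) (x y : U), fmul (a *: x) y = a *: fmul x y;
  fmul_ge0 : forall x y : U, 0 <= x -> 0 <= y -> 0 <= fmul x y;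
  fmul_disjoint : forall x y z : U,
    0 <= z -> rmeet x y = 0 -> rmeet (fmul z x) y = 0
}.

#[short(type="fAlgebraType")]
HB.structure Definition FAlgebra (R : realType) :=
  { U of RieszSpace_isFAlgebra R U & RieszSpace R U }.

Section RieszSpaces.
Context {R : realType}.
Implicit Types E : rieszType R.

Definition rabs E (x : E) : E := rjoin x (- x).
Definition rpos E (x : E) : E := rjoin x 0.
Definition rneg E (x : E) : E := rjoin (- x) 0.

Definition dedekind_complete E : Prop :=
  forall A : set E, has_sup A -> supremums A !=set0.

Definition laterally_complete E : Prop :=
  forall A : set E, A !=set0 -> (forall x, A x -> 0 <= x) ->
    (forall x y, A x -> A y -> x <> y -> rmeet x y = 0) ->
    supremums A !=set0.

Definition universally_complete E : Prop :=
  dedekind_complete E /\ laterally_complete E.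

Definition weak_order_unit E (e : E) : Prop :=
  0 <= e /\ forall x : E, rmeet (rabs x) e = 0 -> x = 0.

Definition linear_subspace E (V : set E) : Prop :=
  V 0 /\ forall (a : R) (x y : E), V x -> V y -> V (a *: x + y).

Definition riesz_subspace E (V : set E) : Prop :=
  linear_subspace V /\
  forall x y, V x -> V y -> V (rjoin x y) /\ V (rmeet x y).

Definition order_ideal E (I : set E) : Prop :=
  linear_subspace I /\ forall x y, I y -> rabs x <= rabs y -> I x.

(* Dedekind completeness of [V] in the order of [V] itself: the suprema are
   least among the upper bounds belonging to [V]. *)
Definition dedekind_complete_in E (V : set E) : Prop :=
  forall A : set E, A `<=` V -> A !=set0 -> ubound A `&` V !=set0 ->
    exists s, [/\ V s, ubound A s & forall u, V u -> ubound A u -> s <= u].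

(* A monotone net is represented by its set of values. *)
Definition directed_up E (D : set E) : Prop :=
  D !=set0 /\
  forall x y, D x -> D y -> exists z, [/\ D z, x <= z & y <= z].

Definition directed_down E (D : set E) : Prop :=
  D !=set0 /\
  forall x y, D x -> D y -> exists z, [/\ D z, z <= x & z <= y].

(* [x_a] decreasing to 0 implies [F x_a] decreasing to 0; this is order
   continuity for positive [F]. *)
Definition order_continuous E (F : E -> E) : Prop :=
  forall D : set E, directed_down D -> infimums D 0 -> infimums (F @` D) 0.

Definition strictly_positive E (F : E -> E) : Prop :=
  forall x : E, 0 < x -> 0 < F x.

Record conditional_expectation E (e : E) (F : {linear E -> E}) : Prop := {
  ce_strictly_positive : strictly_positive F;
  ce_order_continuous : order_continuous F;
  ce_projection : forall x, F (F x) = F x;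
  ce_unit : F e = e;
  ce_range_riesz : riesz_subspace (range F);
  ce_range_complete : dedekind_complete_in (range F)
}.

Record filtration E (e : E) (T : nat) (F : nat -> {linear E -> E}) : Prop := {
  filtration_ce : forall t, (t <= T)%N -> conditional_expectation e (F t);
  filtration_tower : forall i j, (i < j <= T)%N ->
    forall x, F i (F j x) = F i x /\ F j (F i x) = F i x
}.

Record universal_completion E (U : rieszType R) (iota : {linear E -> U}) :
    Prop := {
  uc_complete : universally_complete U;
  uc_inj : injective iota;
  uc_join : {morph iota : x y / rjoin x y};
  uc_meet : {morph iota : x y / rmeet x y};
  uc_order_dense : forall u : U, 0 < u -> exists x : E, 0 < iota x <= u
}.

End RieszSpaces.

Section NaturalDomain.
Context {R : realType} {E U : rieszType R}.
Variables (iota : {linear E -> U}) (F : {linear E -> E}).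

Definition increases_to (D : set E) (z : U) : Prop :=
  [/\ directed_up D, (forall x, D x -> 0 <= x) & supremums (iota @` D) z].

Definition L1_pos : set U :=
  [set z | exists D, increases_to D z /\ has_ubound (iota @` (F @` D))].

Definition L1 : set U := [set z | L1_pos (rpos z) /\ L1_pos (rneg z)].

(* Graph of the extension of [F] to the positive cone of [L1]. *)
Definition ext_pos (z w : U) : Prop :=
  exists D, increases_to D z /\ supremums (iota @` (F @` D)) w.

(* Graph of the extension of [F] to [L1]. *)
Definition ext (z w : U) : Prop :=
  exists w1 w2, [/\ ext_pos (rpos z) w1, ext_pos (rneg z) w2 & w = w1 - w2].

Definition ext_range : set U := [set w | exists2 z, L1 z & ext z w].

Definition Linfty : set U := smallest (@order_ideal R U) ext_range.

Definition M_sup (f : U) : U := infimum 0 [set g | ext_range g /\ f <= g].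

Definition m_inf (f : U) : U := supremum 0 [set g | ext_range g /\ g <= f].

End NaturalDomain.

Section Market.
Context {R : realType} {E : rieszType R} {U : fAlgebraType R}.
Variables (iota : {linear E -> U}) (T : nat) (F : nat -> {linear E -> E}).
Variable (S : nat -> U).

Record price_process : Prop := {
  price_adapted : forall t, (t <= T)%N -> ext_range iota (F t) (S t);
  price_ge0 : forall t, (t <= T)%N -> 0 <= S t;
  price_Linfty : forall t, (t < T)%N -> Linfty iota (F t) (S t.+1)
}.

Definition increment (i : nat) : U := S i - S i.-1.

Definition terminal_values (t : nat) : set U :=
  [set v | exists2 theta : nat -> U,
     (forall i, (t <= i < T)%N -> ext_range iota (F i) (theta i)) &
     v = \sum_(t.+1 <= i < T.+1) fmul (theta i.-1) (increment i)].

Definition superhedging_prices (t : nat) : set U :=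
  [set p | ext_range iota (F t) p /\
     exists2 v, terminal_values t v & 0 <= p + v].

Definition AIP : Prop :=
  forall t, (t < T)%N ->
    superhedging_prices t `&` [set p | ext_range iota (F t) p /\ p <= 0]
      = [set 0].

End Market.

(* Main.v *)
From HB Require Import structures.
Require Import Defs.
From mathcomp Require Import all_boot all_order all_algebra.
From mathcomp Require Import boolp classical_sets reals.
From mathcomp Require Import ring.

(** For a conditional expectation [F], order continuity makes [V], the image of
    [range F] in [U], closed under suprema bounded in [V]; the range of the
    extension consists of the elements all of whose truncations by multiples of
    the unit lie in [V]. Infinite distributivity makes it closed under all
    suprema existing in [U], and a monotone class argument makes it linear. It
    is then closed under products, because squares are suprema of lattice
    expressions.

    If [g] in [R(F_t)] lies below [S_(t+1)] and [a = (g - S_t)^+], holding [a]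
    units super-hedges zero from the price [-a^2], so AIP forces [a = 0]; upper
    bounds are symmetric. Conversely, if [b + th (S_(t+1) - S_t) >= 0] with [b]
    and [th] in [R(F_t)], then where [b < 0 < th] the element [S_t - b/th] would
    be a better lower bound of [S_(t+1)], and symmetrically for [th < 0]; hence
    [b >= 0], and the last time step of any super-hedge of zero can be peeled
    off. *)

Set Implicit Arguments.
Unset Strict Implicit.
Unset Printing Implicit Defensive.

Import Order.TTheory GRing.Theory Num.Theory.

Local Open Scope classical_set_scope.
Local Open Scope ring_scope.

(** * Riesz spaces: lattice identities, suprema and the Archimedean property *)

Section Riesz.
Context {R : realType} {E : rieszType R}.
Implicit Types (x y z : E) (A : set E).

Lemma riesz_leD2 z x y : (x + z <= y + z) = (x <= y).
Proof.
apply/idP/idP => [h|]; last exact: riesz_leD2r.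
by have := riesz_leD2r (- z) _ _ h; rewrite !addrK.
Qed.

Lemma riesz_subr_ge0 x y : (0 <= y - x) = (x <= y).
Proof. by rewrite -[LHS](riesz_leD2 x) add0r subrK. Qed.

Lemma riesz_leD x y x' y' : x <= y -> x' <= y' -> x + x' <= y + y'.
Proof.
move=> h h'; apply: (@le_trans _ _ (y + x')); first by rewrite riesz_leD2.
by rewrite ![y + _]addrC riesz_leD2.
Qed.

Lemma riesz_addr_ge0 x y : 0 <= x -> 0 <= y -> 0 <= x + y.
Proof. by move=> hx hy; rewrite -(addr0 0); apply: riesz_leD. Qed.

Lemma riesz_leBl x y z : (x - y <= z) = (x <= z + y).
Proof. by rewrite -[LHS](riesz_leD2 y) subrK. Qed.

Lemma riesz_leBr x y z : (x <= y - z) = (x + z <= y).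
Proof. by rewrite -[LHS](riesz_leD2 z) subrK. Qed.

Lemma riesz_leN2 x y : (- x <= - y) = (y <= x).
Proof. by rewrite -[LHS]riesz_subr_ge0 opprK addrC riesz_subr_ge0. Qed.

Lemma riesz_leNl x y : (- x <= y) = (- y <= x).
Proof. by rewrite -[LHS]riesz_leN2 opprK. Qed.

Lemma riesz_leNr x y : (x <= - y) = (y <= - x).
Proof. by rewrite -[LHS]riesz_leN2 opprK. Qed.

Lemma riesz_oppr_le0 x : (- x <= 0) = (0 <= x).
Proof. by rewrite riesz_leNl oppr0. Qed.

Lemma riesz_leZ (a : R) x y : 0 <= a -> x <= y -> a *: x <= a *: y.
Proof.
by move=> a0 xy; rewrite -riesz_subr_ge0 -scalerBr riesz_scale_ge0 ?riesz_subr_ge0.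
Qed.

Lemma riesz_leZ2 (a : R) x y : 0 < a -> (a *: x <= a *: y) = (x <= y).
Proof.
move=> a0; apply/idP/idP => [|]; last exact/riesz_leZ/ltW.
have ai : 0 <= a^-1 by rewrite invr_ge0 ltW.
by move=> /(riesz_leZ ai); rewrite !scalerA mulVf ?gt_eqF// !scale1r.
Qed.

Lemma riesz_le_mulrn x y n : x <= y -> x *+ n <= y *+ n.
Proof. by move=> xy; rewrite -!(scaler_nat n); apply: riesz_leZ. Qed.

Lemma rjoin_ub x y : (x <= rjoin x y) * (y <= rjoin x y).
Proof. by have := rjoin_le x y (rjoin x y); rewrite lexx => /esym/andP[-> ->]. Qed.

Lemma rmeet_lb x y : (rmeet x y <= x) * (rmeet x y <= y).
Proof. by have := le_rmeet x y (rmeet x y); rewrite lexx => /esym/andP[-> ->]. Qed.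

Lemma rjoinC x y : rjoin x y = rjoin y x.
Proof. by apply: le_anti; rewrite !rjoin_le !rjoin_ub. Qed.

Lemma rmeetC x y : rmeet x y = rmeet y x.
Proof. by apply: le_anti; rewrite !le_rmeet !rmeet_lb. Qed.

Lemma rmeet_mono x y x' y' : x <= x' -> y <= y' -> rmeet x y <= rmeet x' y'.
Proof.
by move=> hx hy; rewrite le_rmeet !(le_trans _ hx, le_trans _ hy) ?rmeet_lb.
Qed.

Lemma rjoin_mono x y x' y' : x <= x' -> y <= y' -> rjoin x y <= rjoin x' y'.
Proof. by move=> hx hy; rewrite rjoin_le !(le_trans hx, le_trans hy) ?rjoin_ub. Qed.

Lemma rjoin_l x y : y <= x -> rjoin x y = x.
Proof. by move=> yx; apply: le_anti; rewrite rjoin_ub rjoin_le lexx yx. Qed.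

Lemma rmeet_l x y : x <= y -> rmeet x y = x.
Proof. by move=> yx; apply: le_anti; rewrite rmeet_lb le_rmeet lexx yx. Qed.

Lemma rjoinN x y : - rjoin x y = rmeet (- x) (- y).
Proof.
apply: le_anti; rewrite le_rmeet !riesz_leN2 !rjoin_ub /=.
by rewrite riesz_leNr rjoin_le -!(riesz_leNr (rmeet _ _)) !rmeet_lb.
Qed.

Lemma rmeetN x y : - rmeet x y = rjoin (- x) (- y).
Proof. by rewrite -[RHS]opprK rjoinN !opprK. Qed.

Lemma rjoinDr x y z : rjoin x y + z = rjoin (x + z) (y + z).
Proof.
apply: le_anti; rewrite rjoin_le !riesz_leD2 !rjoin_ub andbT.
by rewrite -riesz_leBr rjoin_le !riesz_leBr !rjoin_ub.
Qed.

Lemma rmeetDr x y z : rmeet x y + z = rmeet (x + z) (y + z).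
Proof. by apply: oppr_inj; rewrite opprD !rmeetN rjoinDr !opprD. Qed.

Lemma rjoin_add_rmeet x y : rjoin x y + rmeet x y = x + y.
Proof.
apply/esym/(canRL (subrK _)); rewrite rmeetN addrC rjoinDr rjoinC.
by rewrite addKr addrC addrK.
Qed.

Lemma rmeetE x y : rmeet x y = x - rpos (x - y).
Proof.
by rewrite /rpos rjoinN opprB oppr0 addrC rmeetDr subrK add0r rmeetC.
Qed.

Lemma rpos_ge0 x : 0 <= rpos x. Proof. exact: (rjoin_ub _ _).2. Qed.

Lemma rneg_ge0 x : 0 <= rneg x. Proof. exact: (rjoin_ub _ _).2. Qed.

Lemma rposBneg x : rpos x - rneg x = x.
Proof.
apply/esym/(canRL (addrK _)); rewrite addrC /rneg /rpos rjoinDr addNr add0r.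
exact: rjoinC.
Qed.

Lemma rmeet_pos_neg x : rmeet (rpos x) (rneg x) = 0.
Proof.
rewrite -{1}(subrK (rneg x) (rpos x)) rposBneg -{2}(add0r (rneg x)) -rmeetDr.
by rewrite -(opprK (rmeet _ _)) rmeetN oppr0 addNr.
Qed.

Lemma rabs_ge0 x : 0 <= rabs x.
Proof.
rewrite -(@riesz_leZ2 2)// scaler0 scaler_nat mulr2n -(subrr x).
by apply: riesz_leD; rewrite rjoin_ub.
Qed.

Lemma rabs_le x y : (rabs x <= y) = (- y <= x) && (x <= y).
Proof. by rewrite rjoin_le (riesz_leNl x) andbC. Qed.

Lemma rabsE x : rabs x = rpos x + rneg x.
Proof.
rewrite -rjoin_add_rmeet rmeet_pos_neg addr0; apply: le_anti.
rewrite !rjoin_le !rabs_ge0 !rjoin_ub !andbT /=.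
apply/andP; split.
  by apply: le_trans (rjoin_ub _ _).1; exact: (rjoin_ub _ _).1.
by apply: le_trans (rjoin_ub _ _).2; exact: (rjoin_ub _ _).1.
Qed.

Lemma supremums_unique A x y : supremums A x -> supremums A y -> x = y.
Proof. by move=> [ux lx] [uy ly]; apply: le_anti; rewrite lx ?ly. Qed.

Lemma supremumsD A x z : supremums A x -> supremums ((fun y => y + z) @` A) (x + z).
Proof.
move=> [ux lx]; split=> [_ [y Ay <-]|t ut]; first by rewrite riesz_leD2; exact: ux.
by rewrite -riesz_leBr; apply: lx => y Ay; rewrite riesz_leBr; apply: ut; exists y.
Qed.

Lemma supremumsZ A x (a : R) : 0 < a ->
  supremums A x -> supremums ((fun y => a *: y) @` A) (a *: x).
Proof.
move=> a0 [ux lx]; split=> [_ [y Ay <-]|z uz].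
  by rewrite riesz_leZ2//; exact: ux.
have aK : a *: (a^-1 *: z) = z by rewrite scalerA divff ?gt_eqF// scale1r.
rewrite -aK riesz_leZ2//; apply: lx => y Ay; rewrite -(@riesz_leZ2 a)// aK.
by apply: uz; exists y.
Qed.

(** Infinite distributivity: [y + z] is the sum of [rjoin y z] and [rmeet y z], and
    [rjoin y z <= rjoin x z], so a bound on the meets yields one on [y]. *)
Lemma supremums_rmeet A x z :
  supremums A x -> supremums ((fun y => rmeet y z) @` A) (rmeet x z).
Proof.
move=> [ux lx]; split=> [_ [y Ay <-]|t ut].
  by rewrite rmeet_mono//; exact: ux.
rewrite -(riesz_leD2 (rjoin x z)) addrC rjoin_add_rmeet -riesz_leBr.
apply: lx => y Ay; rewrite riesz_leBr -rjoin_add_rmeet addrC riesz_leD//.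
  by apply: ut; exists y.
by apply: rjoin_mono => //; exact: ux.
Qed.

Lemma supremums_rjoin A x z : A !=set0 ->
  supremums A x -> supremums ((fun y => rjoin y z) @` A) (rjoin x z).
Proof.
move=> [a Aa] [ux lx]; split=> [_ [y Ay <-]|t ut].
  by apply: rjoin_mono => //; exact: ux.
rewrite rjoin_le; apply/andP; split.
  by apply: lx => y Ay; apply: le_trans (rjoin_ub y z).1 _; apply: ut; exists y.
by apply: le_trans (rjoin_ub a z).2 _; apply: ut; exists a.
Qed.

Lemma rjoin_supremum x y : supremums [set x; y] (rjoin x y).
Proof.
split=> [_ [|] ->|z uz]; rewrite ?rjoin_ub// rjoin_le.
by rewrite !uz//; [right|left].
Qed.

Lemma rmeet_rjoinl x y z : rmeet (rjoin x y) z = rjoin (rmeet x z) (rmeet y z).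
Proof.
apply: supremums_unique (supremums_rmeet z (rjoin_supremum x y)) _.
by rewrite image_setU !image_set1; exact: rjoin_supremum.
Qed.

(** The supremum [s] of the multiples of [x] satisfies [s + x <= s], since adding [x] only shifts
    them. *)
Lemma archimedean (Ec : dedekind_complete E) x y :
  (forall n : nat, x *+ n <= y) -> x <= 0.
Proof.
move=> xy; have [|s [us ls]] := Ec (range (fun n => x *+ n)).
  split; first by exists 0, 0.
  by exists y => _ [n _ <-].
rewrite -(riesz_leD2 s) add0r addrC -riesz_leBr; apply: ls => _ [n _ <-].
by rewrite riesz_leBr -mulrSr; apply: us; exists n.+1.
Qed.

End Riesz.

(* Makes the ring notations and the [ring] tactic available on [U]; the
   products of the statement remain convertible to the new ones. *)
#[non_forgetful_inheritance]
HB.instance Definition _ (R : realType) (U : fAlgebraType R) :=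
  GRing.Zmodule_isComPzRing.Build (FAlgebra.sort U)
    (@fmulA R U) (@fmulC R U) (@fmul1 R U) (@fmulDl R U).

(** * f-algebras: disjointness, squares and truncation at multiples of the unit *)

Section FAlgebra.
Context {R : realType} {U : fAlgebraType R}.
Implicit Types (x y z : U) (A : set U).

Lemma falg_mulr_ge0 x y : 0 <= x -> 0 <= y -> 0 <= x * y.
Proof. exact: fmul_ge0. Qed.

Lemma falg_scalerAl (a : R) x y : (a *: x) * y = a *: (x * y).
Proof. exact: fmulZl. Qed.

Lemma falg_ler_wpM2r x y z : 0 <= z -> x <= y -> x * z <= y * z.
Proof.
by move=> z0 xy; rewrite -riesz_subr_ge0 -mulrBl falg_mulr_ge0// riesz_subr_ge0.
Qed.

Lemma falg_ler_pM x y x' y' : 0 <= x -> 0 <= x' -> x <= y -> x' <= y' ->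
  x * x' <= y * y'.
Proof.
move=> x0 x'0 xy xy'; apply: le_trans (falg_ler_wpM2r x'0 xy) _.
by rewrite ![y * _]mulrC falg_ler_wpM2r// (le_trans x0).
Qed.

(** Disjointness survives multiplying either side by a positive element, so [x * y] is disjoint from
    itself. *)
Lemma rmeet0_mul0 x y : rmeet x y = 0 -> x * y = 0.
Proof.
move=> xy0; have x0 : 0 <= x by rewrite -xy0 rmeet_lb.
have y0 : 0 <= y by rewrite -xy0 rmeet_lb.
have := fmul_disjoint _ _ _ x0 (etrans (rmeetC _ _) (fmul_disjoint _ _ _ y0 xy0)).
by rewrite (fmulC y x) rmeet_l.
Qed.

Lemma rpos_mul_rneg x : rpos x * rneg x = 0.
Proof. exact/rmeet0_mul0/rmeet_pos_neg. Qed.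

Lemma mul_rpos x : x * rpos x = rpos x ^+ 2.
Proof. by rewrite -{1}(rposBneg x) mulrBl (mulrC (rneg x)) rpos_mul_rneg subr0. Qed.

Lemma mul_rneg x : x * rneg x = - rneg x ^+ 2.
Proof. by rewrite -{1}(rposBneg x) mulrBl rpos_mul_rneg sub0r. Qed.

Lemma sqr_rpos_rneg x : x ^+ 2 = rpos x ^+ 2 + rneg x ^+ 2.
Proof.
rewrite -{1}(rposBneg x) sqrrB rpos_mul_rneg.
by rewrite mul0rn subr0.
Qed.

Lemma rabs_sqr x : rabs x ^+ 2 = x ^+ 2.
Proof. by rewrite rabsE sqrrD rpos_mul_rneg mul0rn addr0 sqr_rpos_rneg. Qed.

Lemma falg_sqr_ge0 x : 0 <= x ^+ 2.
Proof. by rewrite -rabs_sqr expr2 falg_mulr_ge0// rabs_ge0. Qed.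

Lemma falg_natr_ge0 n : 0 <= n%:R :> U.
Proof. by rewrite -(mul0rn _ n) riesz_le_mulrn// -(expr1n U 2) falg_sqr_ge0. Qed.

Lemma falg_oppr_natr_le n m : - m%:R <= n%:R :> U.
Proof.
by apply: (@le_trans _ _ 0); rewrite ?riesz_oppr_le0 falg_natr_ge0.
Qed.

(** Rests on [4x^2 - 4n(x - n) = (2x - n)^2 + 3n^2]. Truncation at height [n] thus has an error of
    order [1/n], as Archimedean arguments require. *)
Lemma rpos_sub_natr_le x n : rpos (x - n%:R) *+ n <= x ^+ 2.
Proof.
case: n => [|n]; first by rewrite mulr0n falg_sqr_ge0.
have n0 : (0 : R) < n.+1%:R by [].
have nK z : n.+1%:R *: (n.+1%:R^-1 *: z : U) = z.
  by rewrite scalerA divff ?scale1r// lt0r_neq0.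
rewrite -[_ *+ _](scaler_nat n.+1) -(nK (x ^+ 2)) riesz_leZ2//.
rewrite rjoin_le riesz_scale_ge0 ?invr_ge0 ?falg_sqr_ge0//.
rewrite andbT -(riesz_leZ2 _ _ n0) nK scaler_nat.
rewrite -(@riesz_leZ2 _ _ 4)// !scaler_nat -riesz_subr_ge0.
have -> : x ^+ 2 *+ 4 - (x - n.+1%:R) *+ n.+1 *+ 4 =
    (x *+ 2 - n.+1%:R) ^+ 2 + n.+1%:R ^+ 2 *+ 3 by ring.
by rewrite riesz_addr_ge0 ?falg_sqr_ge0// -(mul0rn _ 3) riesz_le_mulrn ?falg_sqr_ge0.
Qed.

Hypothesis Uc : dedekind_complete U.

(** If [z^2 = 0] then [0 <= (1 - nz)^2 = 1 - 2nz] for every [n], whence [z <= 0]; the same holds for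
    [-z]. *)
Lemma sqr_eq0 x : x ^+ 2 <= 0 -> x = 0.
Proof.
have le0 z : z ^+ 2 <= 0 -> z <= 0.
  move=> z2; have z20 : z ^+ 2 = 0 by apply: le_anti; rewrite z2 falg_sqr_ge0.
  rewrite -(@riesz_leZ2 _ _ 2)// scaler0 scaler_nat.
  apply: (@archimedean R U Uc _ 1) => n; rewrite -riesz_subr_ge0.
  have -> : 1 - z *+ 2 *+ n = (1 - z *+ n) ^+ 2 - z ^+ 2 *+ (n * n) by ring.
  by rewrite z20 mul0rn subr0 falg_sqr_ge0.
move=> x2; apply: le_anti; rewrite le0//= -(riesz_oppr_le0 x) le0 ?sqrrN//.
Qed.

Lemma mul_ge0_rneg x y : 0 <= x -> 0 <= x * y -> x * rneg y = 0.
Proof.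
move=> x0 xy; apply: sqr_eq0; rewrite exprMn -(opprK (_ * _)) riesz_oppr_le0.
have -> : - (x ^+ 2 * rneg y ^+ 2) = (x * y) * (x * rneg y).
  by rewrite -mulrN -mul_rneg; ring.
by rewrite falg_mulr_ge0// falg_mulr_ge0// rneg_ge0.
Qed.

Lemma mul0_rmeet x y : 0 <= x -> 0 <= y -> x * y = 0 -> rmeet x y = 0.
Proof.
move=> x0 y0 xy; have m0 : 0 <= rmeet x y by rewrite le_rmeet x0.
by apply: sqr_eq0; rewrite -xy falg_ler_pM// rmeet_lb.
Qed.

(** An upper bound [z] satisfies [x - z <= (x - n)^+], hence [n(x - z) <= x^2] for all [n]. *)
Lemma supremums_rmeet_natr x : supremums (range (fun n => rmeet x n%:R)) x.
Proof.
split=> [_ [n _ <-]|z uz]; first by rewrite rmeet_lb.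
rewrite -(riesz_leD2 (- z)) subrr.
apply: (@archimedean R U Uc _ (x ^+ 2)) => n.
apply: le_trans (rpos_sub_natr_le x n); apply: riesz_le_mulrn.
rewrite riesz_leBl addrC -riesz_leBl -rmeetE; apply: uz.
by exists n.
Qed.

End FAlgebra.

(** * Order closed subspaces: products and the one-period hedging inequality *)

Record order_closed_space (R : realType) (U : fAlgebraType R) (W : set U) :
    Prop := {
  ocs_linear : linear_subspace W;
  ocs_one : W 1;
  ocs_sup : forall A x, A `<=` W -> A !=set0 -> supremums A x -> W x
}.

Section OrderClosedSpace.
Context {R : realType} {U : fAlgebraType R} (W : set U).
Hypotheses (Uc : dedekind_complete U) (Wc : order_closed_space W).
Implicit Types (x y s b th : U).

Lemma ocs0 : W 0.
Proof. exact: (ocs_linear Wc).1. Qed.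

Lemma ocsZ (a : R) x : W x -> W (a *: x).
Proof.
by move=> Wx; rewrite -[_ *: _]addr0; apply: (ocs_linear Wc).2 => //; exact: ocs0.
Qed.

Lemma ocsD x y : W x -> W y -> W (x + y).
Proof. by move=> Wx Wy; rewrite -(scale1r x); apply: (ocs_linear Wc).2. Qed.

Lemma ocsN x : W x -> W (- x).
Proof. by rewrite -scaleN1r; exact: ocsZ. Qed.

Lemma ocsB x y : W x -> W y -> W (x - y).
Proof. by move=> Wx Wy; apply/ocsD/ocsN. Qed.

Lemma ocsMn x n : W x -> W (x *+ n).
Proof. by rewrite -scaler_nat; exact: ocsZ. Qed.

Lemma ocs_rjoin x y : W x -> W y -> W (rjoin x y).
Proof.
move=> Wx Wy; apply: (ocs_sup Wc) (rjoin_supremum x y); last by exists x; left.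
by move=> _ [|] ->.
Qed.

Lemma ocs_rmeet x y : W x -> W y -> W (rmeet x y).
Proof.
move=> Wx Wy; rewrite -[rmeet _ _]opprK rmeetN.
by apply/ocsN/ocs_rjoin; apply/ocsN.
Qed.

Lemma ocs_rpos x : W x -> W (rpos x).
Proof. by move=> Wx; apply: ocs_rjoin => //; exact: ocs0. Qed.

Lemma ocs_rneg x : W x -> W (rneg x).
Proof. by move=> Wx; apply: ocs_rjoin; [exact: ocsN|exact: ocs0]. Qed.

Lemma ocs_rabs x : W x -> W (rabs x).
Proof. by move=> Wx; apply/ocs_rjoin/ocsN. Qed.

(* With [x1 = |x| - r/2] one has [x^2 = x1^2 + r|x| - (r/2)^2] and
   [|x1| <= r/2], so iterating expresses [x^2] through lattice operations. *)
Lemma ocs_sqr_approx K (r : R) x : 0 <= r -> W x -> rabs x <= r *: (1 : U) ->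
  exists s, [/\ W s, s <= x ^+ 2 & x ^+ 2 <= s + (r ^+ 2 / 4 ^+ K) *: (1 : U)].
Proof.
elim: K r x => [|K IH] r x r0 Wx xr.
  exists 0; split; [exact: ocs0|exact: falg_sqr_ge0|].
  rewrite add0r expr0 divr1 -rabs_sqr.
  have -> : r ^+ 2 *: (1 : U) = (r *: (1 : U)) * (r *: (1 : U)) :> U.
    by rewrite falg_scalerAl mul1r scalerA expr2.
  by rewrite expr2 falg_ler_pM// rabs_ge0.
set h : U := (r / 2) *: (1 : U).
have hh : h + h = r *: (1 : U) by rewrite -scalerDl -splitr.
have r20 : 0 <= r / 2 by rewrite divr_ge0.
have [|||s [Ws s1 s2]] := IH (r / 2) (rabs x - h) => //.
- by apply: ocsB; [exact: ocs_rabs|apply/ocsZ/(ocs_one Wc)].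
- rewrite -/h rabs_le riesz_leBl hh xr andbT.
  by rewrite -(riesz_leD2 h) subrK addNr rabs_ge0.
have e : (rabs x - h) ^+ 2 + (r *: rabs x - h ^+ 2) = x ^+ 2.
  have -> : r *: rabs x = (h + h) * rabs x by rewrite hh falg_scalerAl mul1r.
  by rewrite -(rabs_sqr x); ring.
exists (s + (r *: rabs x - h ^+ 2)); split.
- apply: ocsD => //; apply: ocsB; first exact/ocsZ/ocs_rabs.
  rewrite expr2 falg_scalerAl mul1r; apply/ocsZ/ocsZ; exact: (ocs_one Wc).
- by rewrite -e riesz_leD2.
- rewrite -e addrAC riesz_leD2; apply: le_trans s2 _.
  have -> // : (r / 2) ^+ 2 / 4 ^+ K = r ^+ 2 / 4 ^+ K.+1.
  by rewrite (exprS 4 K); field; rewrite lt0r_neq0 ?exprn_gt0.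
Qed.

(** The elements of [W] below [x^2] have supremum [x^2]: the error [r^2 / 4^n], multiplied by [n],
    stays at most [r^2]. *)
Lemma ocs_sqr_bounded (r : R) x :
  0 <= r -> W x -> rabs x <= r *: (1 : U) -> W (x ^+ 2).
Proof.
move=> r0 Wx xr.
apply: (ocs_sup Wc) (_ : supremums [set s | W s /\ s <= x ^+ 2] _).
- by move=> s [].
- by exists 0; split; [exact: ocs0|exact: falg_sqr_ge0].
split=> [s [] //|z uz]; rewrite -(riesz_leD2 (- z)) subrr.
apply: (@archimedean R U Uc _ (r ^+ 2 *: (1 : U))) => n.
have [s [Ws s1 s2]] := ocs_sqr_approx n r0 Wx xr.
have sz : x ^+ 2 - z <= (r ^+ 2 / 4 ^+ n) *: (1 : U).
  by rewrite riesz_leBl addrC; apply: le_trans s2 _; rewrite riesz_leD2; exact: uz.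
apply: le_trans (riesz_le_mulrn n sz) _.
rewrite -scaler_nat scalerA -riesz_subr_ge0 -scalerBl.
apply: riesz_scale_ge0; last exact: (falg_natr_ge0 1).
rewrite subr_ge0 mulrCA ler_piMr ?sqr_ge0//.
rewrite ler_pdivrMr ?exprn_gt0// mul1r -natrX ler_nat.
by rewrite ltnW// ltn_expl.
Qed.

(** For the truncations [t n], [x^2 - (t n)^2 = (x - n)^+ (x + t n) <= 2x (x - n)^+], and [n] times
    this is at most [2x^3]. *)
Lemma ocs_sqr_ge0 x : 0 <= x -> W x -> W (x ^+ 2).
Proof.
move=> x0 Wx; set t := fun n : nat => rmeet x n%:R.
have t0 n : 0 <= t n by rewrite le_rmeet x0 falg_natr_ge0.
apply: (ocs_sup Wc) (_ : supremums (range (fun n => t n ^+ 2)) _).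
- move=> _ [n _ <-]; apply: (@ocs_sqr_bounded n%:R) => //.
    by apply: ocs_rmeet => //; apply/ocsMn/(ocs_one Wc).
  rewrite rabs_le scaler_nat rmeet_lb andbT (le_trans _ (t0 n))//.
  by rewrite riesz_oppr_le0 falg_natr_ge0.
- by exists (t 0 ^+ 2), 0.
split=> [_ [n _ <-]|z uz]; first by rewrite !expr2 falg_ler_pM// rmeet_lb.
rewrite -(riesz_leD2 (- z)) subrr.
apply: (@archimedean R U Uc _ (x ^+ 2 * (x *+ 2))) => n.
apply: (@le_trans _ _ ((rpos (x - n%:R) *+ n) * (x *+ 2))); last first.
  by apply: falg_ler_wpM2r (rpos_sub_natr_le x n); rewrite -(mul0rn _ 2) riesz_le_mulrn.
rewrite mulrnAl; apply: riesz_le_mulrn; rewrite riesz_leBl addrC -riesz_leBl.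
apply: (@le_trans _ _ (t n ^+ 2)); last by apply: uz; exists n.
rewrite riesz_leBl addrC -riesz_leBl subr_sqr.
have -> : x - t n = rpos (x - n%:R) by rewrite /t rmeetE opprB addrC subrK.
rewrite !(mulrC (rpos _ : U)) falg_ler_wpM2r ?rpos_ge0//.
by rewrite mulr2n riesz_leD// rmeet_lb.
Qed.

Lemma ocsM x y : W x -> W y -> W (x * y).
Proof.
have sqr z : W z -> W (z ^+ 2).
  by move=> Wz; rewrite -rabs_sqr; apply: ocs_sqr_ge0 (rabs_ge0 z) (ocs_rabs Wz).
move=> Wx Wy.
have -> : x * y = 2^-1 *: ((x + y) ^+ 2 - x ^+ 2 - y ^+ 2).
  have -> : (x + y) ^+ 2 - x ^+ 2 - y ^+ 2 = (x * y) *+ 2 by ring.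
  by rewrite -scaler_nat scalerA mulVf ?scale1r ?pnatr_eq0.
by apply/ocsZ/ocsB; [apply/ocsB/sqr => //; apply/sqr/ocsD|exact: sqr].
Qed.

(* Where [b < 0 < th < n] the hypothesis gives [s' >= s + b^-/n]. The element
   equal to [s + b^-/n] there and to [0] elsewhere would be a lower bound of
   [s'] exceeding [s]; the meets of [s + b^-/n] with [m x], where [x >= 0] is
   supported there, replace it and avoid band projections. *)
Lemma hedge_rneg_mul_rpos s s' b th : W s -> 0 <= s' -> W b -> W th ->
  0 <= b + th * (s' - s) -> (forall g, W g -> g <= s' -> g <= s) ->
  rneg b * rpos th = 0.
Proof.
move=> Ws s'0 Wb Wth hb hs; set q := rneg b; set t := rpos th.
have q0 : 0 <= q := rneg_ge0 b; have t0 : 0 <= t := rpos_ge0 th.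
(* This is [q] times the hedge, because [q * b = - q ^+ 2]. *)
set P := q * (th * (s' - s) - q).
have P0 : 0 <= P.
  have := falg_mulr_ge0 q0 hb.
  rewrite mulrDr (mulrC q b) mul_rneg -/q.
  by have -> // : P = - q ^+ 2 + q * (th * (s' - s)) by rewrite /P; ring.
have tE : t ^+ 2 = th * t by rewrite mul_rpos.
(* As [n] grows, the Archimedean property turns these bounds into [(q * t)^2 <= 0]. *)
suff qtn n : q ^+ 2 * t ^+ 2 * (n.+1%:R - th) <= 0.
  apply: sqr_eq0 => //; rewrite exprMn.
  apply: (@archimedean R U Uc _ (q ^+ 2 * t ^+ 2 * th)) => n.
  apply: (@le_trans _ _ ((q ^+ 2 * t ^+ 2) *+ n.+1)).
    by rewrite mulrSr -[leLHS]addr0 riesz_leD// -exprMn falg_sqr_ge0.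
  by rewrite -mulr_natr -(riesz_leD2 (- (q ^+ 2 * t ^+ 2 * th))) subrr -mulrBr.
set r := rpos (n.+1%:R - th); have r0 : 0 <= r := rpos_ge0 _.
have rE : r ^+ 2 = (n.+1%:R - th) * r by rewrite mul_rpos.
(* The factors confine [x] to where [b < 0 < th < n + 1]. *)
set x := q * t ^+ 2 * r.
have x0 : 0 <= x by rewrite !falg_mulr_ge0// falg_sqr_ge0.
have Wx : W x.
  have [Wq Wt] : W q /\ W t by split; [exact: ocs_rneg|exact: ocs_rpos].
  apply: ocsM; first by apply/ocsM/ocsM.
  by apply/ocs_rpos/ocsB => //; apply/ocsMn/(ocs_one Wc).
set a := n.+1%:R^-1 *: q; have a0 : 0 <= a by rewrite riesz_scale_ge0// invr_ge0.
have n0 : (n.+1%:R : R) != 0 by rewrite pnatr_eq0.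
have aE : a *+ n.+1 = q by rewrite -scaler_nat scalerA divff// scale1r.
set y := s' - s - a.
have xy : 0 <= x * y.
  rewrite -(@riesz_leZ2 _ _ n.+1%:R)// scaler0 scaler_nat.
  (* Since [t^2 = th * t] and [r^2 = (n + 1 - th) * r], the terms in [th] cancel and only
     nonnegative ones remain. *)
  have -> : (x * y) *+ n.+1 = t ^+ 2 * r * P + t * r ^+ 2 * (P + q ^+ 2).
    have -> : t * r ^+ 2 * (P + q ^+ 2) = q * (s' - s) * (th * t) * r ^+ 2.
      by rewrite /P; ring.
    rewrite -tE rE -mulrnAr mulrnBl aE /x /P.
    by move: (s' - s) => D; ring.
  by move: P P0 => P P0; rewrite !(riesz_addr_ge0, falg_mulr_ge0) ?falg_sqr_ge0.
(* The meet lies below [s'] because [x *+ m] is disjoint from [rneg y]; [s' >= 0] allows replacing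
   [x *+ m - s'] by [x *+ m]. *)
have gs m : rmeet (s + a) (x *+ m) <= s.
  apply: hs.
    by apply: ocs_rmeet; [apply/ocsD/ocsZ/ocs_rneg|exact: ocsMn].
  have y0 : 0 <= rneg y := rneg_ge0 y.
  have xm0 : 0 <= x *+ m by rewrite -(mul0rn _ m) riesz_le_mulrn.
  have -> : s + a = s' - y by rewrite /y; ring.
  apply: (@le_trans _ _ (rmeet (rneg y) (x *+ m - s') + s')).
    rewrite rmeetDr subrK addrC rmeet_mono// riesz_leD2.
    exact: (rjoin_ub _ _).1.
  rewrite -[leRHS]add0r riesz_leD2.
  rewrite -(_ : rmeet (rneg y) (x *+ m) = 0).
    by rewrite rmeet_mono// -[leRHS]subr0 riesz_leD// riesz_leN2.
  by apply: mul0_rmeet => //; rewrite mulrnAr mulrC mul_ge0_rneg// mul0rn.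
(* By [gs] the positive part of [x *+ m - s] is disjoint from [a], so [m] times [a * x] is at most
   [a * s] for every [m]. *)
have ax : a * x <= 0.
  apply: (@archimedean R U Uc _ (a * s)) => m.
  rewrite -mulrnAr -(riesz_leD2 (- (a * s))) subrr -mulrBr.
  set w := x *+ m - s.
  have wa : rmeet w a <= 0.
    rewrite -(riesz_leD2 s) rmeetDr subrK add0r rmeetC [a + s]addrC.
    exact: gs.
  rewrite -(rposBneg w) mulrBr.
  rewrite rmeet0_mul0 ?sub0r ?riesz_oppr_le0 ?falg_mulr_ge0 ?rneg_ge0//.
  apply: le_anti; rewrite le_rmeet a0 rpos_ge0 rmeetC rmeet_rjoinl rjoin_le wa /=.
  rewrite andbT; exact: (rmeet_lb 0 a).1.
have qx : q * x <= 0.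
  by rewrite -aE mulrnAl -(mul0rn _ n.+1) riesz_le_mulrn.
apply: le_trans qx; rewrite /x.
have -> : q * (q * t ^+ 2 * r) = r * (q ^+ 2 * t ^+ 2) by ring.
rewrite mulrC falg_ler_wpM2r ?falg_mulr_ge0 ?falg_sqr_ge0//.
exact: (rjoin_ub _ _).1.
Qed.

(** Both parts of [th] are annihilated by [rneg b], so multiplying the hedge by [rneg b] leaves
    [-(rneg b)^2 >= 0]. *)
Lemma hedge_ge0 s s' N b th : W s -> 0 <= s' -> W N -> s' <= N -> W b -> W th ->
  0 <= b + th * (s' - s) ->
  (forall g, W g -> g <= s' -> g <= s) -> (forall g, W g -> s' <= g -> s <= g) ->
  0 <= b.
Proof.
move=> Ws s'0 WN s'N Wb Wth hb hl hu.
have pos : rneg b * rpos th = 0 by apply: hedge_rneg_mul_rpos hl.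
have neg : rneg b * rneg th = 0.
  have -> : rneg th = rpos (- th) by [].
  (* A short position is a long one in the reflected price [N - s'], nonnegative by the choice of
     [N]; reflection turns upper bounds into lower ones. *)
  apply: (@hedge_rneg_mul_rpos (N - s) (N - s')) => //; last 2 first.
  - rewrite (_ : - th * _ = th * (s' - s))//; ring.
  - move=> g Wg gN; rewrite riesz_leBr addrC -riesz_leBr.
    by apply: hu; [exact: ocsB|rewrite riesz_leBr addrC -riesz_leBr].
  - exact: ocsB.
  - by rewrite riesz_subr_ge0.
  - exact: ocsN.
rewrite -(rposBneg b) (_ : rneg b = 0) ?subr0 ?rpos_ge0//.
have qth : rneg b * th = 0 by rewrite -(rposBneg th) mulrBr pos neg subrr.
apply: sqr_eq0 => //; rewrite -(opprK (_ ^+ 2)) riesz_oppr_le0.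
have := falg_mulr_ge0 (rneg_ge0 b) hb.
by rewrite mulrDr mulrA qth mul0r addr0 mulrC mul_rneg.
Qed.

End OrderClosedSpace.

(** * Truncation closure of a sublattice, by a monotone class argument *)

Record order_closed_sublattice (R : realType) (U : fAlgebraType R) (V : set U) :
    Prop := {
  ocl_riesz : riesz_subspace V;
  ocl_one : V 1;
  ocl_sup : forall A x y, A `<=` V -> A !=set0 -> supremums A x ->
    V y -> x <= y -> V x
}.

(** Separate heights let negation swap them and let the two limits be taken one after the other. *)
Definition truncation (R : realType) (U : fAlgebraType R) (n m : nat) (x : U) : U :=
  rjoin (rmeet x n%:R) (- m%:R).

Definition truncation_closure (R : realType) (U : fAlgebraType R) (V : set U) :
  set U := [set x | forall n m, V (truncation n m x)].

Section TruncationClosure.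
Context {R : realType} {U : fAlgebraType R} (V : set U).
Hypotheses (Uc : dedekind_complete U) (Vc : order_closed_sublattice V).
Implicit Types (x y : U).
Local Notation W := (truncation_closure V).

Lemma oclN x : V x -> V (- x).
Proof.
have [[V0 Vl] _] := ocl_riesz Vc => Vx.
by rewrite -scaleN1r -[_ *: _]addr0; exact: Vl.
Qed.

Lemma ocl_natr n : V n%:R.
Proof.
have [[V0 Vl] _] := ocl_riesz Vc.
rewrite -[_%:R]addr0 -scaler_nat; apply: Vl => //; exact: (ocl_one Vc).
Qed.

Lemma truncationN n m x : truncation n m (- x) = - truncation m n x.
Proof.
rewrite /truncation [RHS]rjoinN rmeetN opprK rmeet_rjoinl.
by rewrite (rmeet_l (falg_oppr_natr_le _ _)).
Qed.

Lemma sub_truncation_closure : V `<=` W.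
Proof.
have [_ Vr] := ocl_riesz Vc => x Vx n m.
by apply: (Vr _ _ _ _).1; [apply: (Vr _ _ Vx (ocl_natr n)).2|apply/oclN/ocl_natr].
Qed.

Lemma truncation_closureN x : W x -> W (- x).
Proof. by move=> Wx n m; rewrite truncationN; exact: oclN. Qed.

(** Truncation commutes with suprema by distributivity, and the constant [n], an element of [V],
    bounds the truncated supremum. *)
Lemma truncation_closure_sup A x :
  A `<=` W -> A !=set0 -> supremums A x -> W x.
Proof.
move=> AW A0 Ax n m; have [a Aa] := A0.
have A'0 : (fun y => rmeet y n%:R) @` A !=set0 by exists (rmeet a n%:R), a.
have := supremums_rjoin (- m%:R : U) A'0 (supremums_rmeet (n%:R : U) Ax).
rewrite image_comp => /(ocl_sup Vc); apply.
- by move=> _ [y Ay <-]; exact: AW.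
- by exists (truncation n m a), a.
- exact: (ocl_natr n).
- by rewrite rjoin_le rmeet_lb falg_oppr_natr_le.
Qed.

(** Starting from truncations in [V], one supremum over the lower height (after a negation) and one
    over the upper height recover [x]. *)
Lemma truncation_closure_ind (P : set U) : V `<=` P ->
  (forall x, P x -> P (- x)) ->
  (forall A x, A `<=` P -> A !=set0 -> supremums A x -> P x) ->
  W `<=` P.
Proof.
move=> VP PN Psup x Wx.
apply: (Psup _ _ _ _ (supremums_rmeet_natr Uc x)); last by exists (rmeet x 0%:R), 0.
move=> _ [n _ <-]; rewrite -[rmeet _ _]opprK; apply: (PN _).
apply: (Psup _ _ _ _ (supremums_rmeet_natr Uc _)); last by eexists; exists 0.
move=> _ [m _ <-]; rewrite -[m%:R]opprK -rjoinN.
exact/PN/VP/Wx.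
Qed.

(** Induction on one summand at a time: first against [V], then, with that as base case, against all
    of [W]. *)
Lemma truncation_closureD x y : W x -> W y -> W (x + y).
Proof.
have WVD u v : W u -> V v -> W (u + v).
  move=> Wu; move: u Wu v.
  apply: truncation_closure_ind => [u Vu v Vv|u uP v Vv|A u AP [a Aa] Au v Vv].
  - apply: sub_truncation_closure; have [[_ Vl] _] := ocl_riesz Vc.
    by rewrite -(scale1r u); exact: Vl.
  - by rewrite -(opprK v) -opprD; apply/truncation_closureN/uP/oclN.
  - apply: truncation_closure_sup (supremumsD v Au); last by exists (a + v), a.
    by move=> _ [b Ab <-]; exact: AP.
move=> Wx; move: x Wx y.
apply: truncation_closure_ind => [u Vu v Wv|u uP v Wv|A u AP [a Aa] Au v Wv].
- by rewrite addrC; exact: WVD.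
- by rewrite -(opprK v) -opprD; apply/truncation_closureN/uP/truncation_closureN.
- apply: truncation_closure_sup (supremumsD v Au); last by exists (a + v), a.
  by move=> _ [b Ab <-]; exact: AP.
Qed.

Lemma truncation_closureZ (a : R) x : W x -> W (a *: x).
Proof.
have [[V0 Vl] _] := ocl_riesz Vc.
have pos (c : R) y : 0 < c -> W y -> W (c *: y).
  move=> c0 Wy; move: y Wy.
  apply: truncation_closure_ind => [u Vu|u uP|A u AP [v Av] Au].
  - by apply: sub_truncation_closure; rewrite -[_ *: _]addr0; exact: Vl.
  - by rewrite scalerN; exact: truncation_closureN.
  - apply: truncation_closure_sup (supremumsZ c0 Au); last by exists (c *: v), v.
    by move=> _ [b Ab <-]; exact: AP.
move=> Wx; case: (ltgtP a 0) => [a0|a0|->]; last 1 first.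
- by rewrite scale0r; exact: sub_truncation_closure.
- by rewrite -(opprK a) scaleNr; apply/truncation_closureN/pos => //; rewrite oppr_gt0.
- exact: pos.
Qed.

Lemma truncation_closure_ocs : order_closed_space W.
Proof.
split; last exact: truncation_closure_sup.
- split; first exact/sub_truncation_closure/(ocl_natr 0).
  by move=> a x y Wx Wy; apply: truncation_closureD => //; exact: truncation_closureZ.
- exact/sub_truncation_closure/(ocl_one Vc).
Qed.

End TruncationClosure.

(** * Conditional expectations: the range of the extension as a truncation closure *)

Section ConditionalExpectation.
Context {R : realType} {E : rieszType R} {U : fAlgebraType R}.
Variables (iota : {linear E -> U}) (e : E) (F : {linear E -> E}).
Hypotheses (Ec : dedekind_complete E) (Uiota : universal_completion iota).
Hypotheses (iota_e : iota e = fone) (Fe : conditional_expectation e F).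

Lemma uc_le x y : (iota x <= iota y) = (x <= y).
Proof.
apply/idP/idP => h; last first.
  by rewrite -(rmeet_l h) (uc_meet Uiota) rmeet_lb.
by rewrite -(uc_inj Uiota (etrans (uc_meet Uiota x y) (rmeet_l h))) rmeet_lb.
Qed.

(** If a bound [z] failed to dominate [iota s], order density would give
    [0 < iota x <= (iota s - z)^+], and [s - x] would still bound [A]. *)
Lemma uc_supremums A s : supremums A s -> supremums (iota @` A) (iota s).
Proof.
move=> [us ls]; split=> [_ [x Ax <-]|z uz]; first by rewrite uc_le; exact: us.
set d := rpos (iota s - z).
case: (eqVneq d 0) => [d0|d0].
  rewrite -(riesz_leD2 (- z)) subrr -d0; exact: (rjoin_ub _ _).1.
have [|x /andP[x0 xd]] := uc_order_dense Uiota (u := d).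
  by rewrite lt_def d0 rpos_ge0.
suff : x <= 0 by rewrite -uc_le linear0 => /(lt_le_trans x0); rewrite ltxx.
rewrite -(riesz_leD2 s) add0r addrC -riesz_leBr; apply: ls => v Av.
rewrite -uc_le linearB /= riesz_leBr addrC -riesz_leBr; apply: le_trans xd _.
rewrite rjoin_le riesz_subr_ge0 uc_le us// andbT.
by rewrite riesz_leD// riesz_leN2; apply: uz; exists v.
Qed.

(** As [v] runs through the range below [s], [s - v] decreases to 0, hence so does [F s - v]: [s]
    and [F s] are suprema of the same elements. *)
Lemma ce_range_sup A s : A `<=` range F -> A !=set0 -> supremums A s ->
  F s = s.
Proof.
move=> AF [a Aa] [us ls].
have fixF v : range F v -> F v = v by move=> [x _ <-]; exact: (ce_projection Fe).
set D := [set s - v | v in [set v | range F v /\ v <= s]].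
have Dv v : range F v -> v <= s -> D (s - v) by move=> Fv vs; exists v.
have Ddir : directed_down D.
  split; first by exists (s - a), a => //; split; [exact: AF|exact: us].
  move=> _ _ [v [Fv vs] <-] [w [Fw ws] <-]; exists (s - rjoin v w); split.
  - by apply: Dv; [exact: ((ce_range_riesz Fe).2 _ _ Fv Fw).1|rewrite rjoin_le vs ws].
  - by rewrite riesz_leD// riesz_leN2 rjoin_ub.
  - by rewrite riesz_leD// riesz_leN2 rjoin_ub.
have D0 : infimums D 0.
  split=> [_ [v [Fv vs] <-]|h hD]; first by rewrite riesz_subr_ge0.
  rewrite -(riesz_leD2 s) add0r addrC -riesz_leBr; apply: ls => v Av.
  rewrite riesz_leBr addrC -riesz_leBr.
  by apply: hD; apply: Dv; [exact: AF|exact: us].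
have [lF gF] := ce_order_continuous Fe Ddir D0.
have FD v : range F v -> v <= s -> (F @` D) (F s - v).
  by move=> Fv vs; exists (s - v); [exact: Dv|rewrite linearB /= (fixF v)].
apply: le_anti; apply/andP; split; last first.
  apply: ls => v Av; rewrite -riesz_subr_ge0.
  by apply/lF/FD; [exact: AF|exact: us].
rewrite -(riesz_leD2 (- s)) subrr; apply: gF => _ [_ [v [Fv vs] <-] <-].
by rewrite linearB /= (fixF v)// riesz_leD// riesz_leN2.
Qed.

Lemma uc_range_ocl : order_closed_sublattice (iota @` range F).
Proof.
have F0 : range F 0 by exists 0; rewrite ?linear0.
split.
- split; last first.
    move=> _ _ [v Fv <-] [w Fw <-].
    have [j m] := (ce_range_riesz Fe).2 _ _ Fv Fw.
    by split; [exists (rjoin v w)|exists (rmeet v w)];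
      rewrite ?(uc_join Uiota) ?(uc_meet Uiota).
  split; first by exists 0; rewrite ?linear0.
  move=> a _ _ [v Fv <-] [w Fw <-]; exists (a *: v + w); last by rewrite linearP.
  exact: (ce_range_riesz Fe).1.2.
- by exists e; [exists e => //; exact: (ce_unit Fe)|].
move=> A x _ AV [a Aa] Ax [y Fy <-] xy.
(* The supremum is formed in [E], where [y] bounds the preimage of [A], and carried back by
   [iota]. *)
set B := [set v | range F v /\ A (iota v)].
have AB : iota @` B = A.
  apply/seteqP; split=> [_ [v [_ Av] <-] //|b Ab].
  by have [v Fv vb] := AV _ Ab; exists v => //; split=> //; rewrite vb.
have B0 : B !=set0.
  by have [v Fv va] := AV _ Aa; exists v; split=> //; rewrite va.
have [|s Bs] := Ec (A := B).
  split=> //; exists y => v [_ Av]; rewrite -uc_le; apply: le_trans xy.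
  exact: Ax.1.
have := uc_supremums Bs; rewrite AB => /(supremums_unique Ax) ->.
exists s => //; exists s => //.
by apply: (ce_range_sup _ B0 Bs) => v [].
Qed.

Local Notation W := (truncation_closure (iota @` range F)).

Lemma ext_pos_closure z w : ext_pos iota F z w -> W w.
Proof.
move=> [D [[[[v Dv] _] _ _] Dw]].
apply: (truncation_closure_sup uc_range_ocl) Dw; last first.
  by exists (iota (F v)), (F v) => //; exists v.
move=> _ [_ [u Du <-] <-]; apply: (sub_truncation_closure uc_range_ocl).
by exists (F u) => //; exists u.
Qed.

Lemma closure_ext_pos z : dedekind_complete U -> W z -> 0 <= z ->
  ext_pos iota F z z /\ L1_pos iota F z.
Proof.
move=> Uc Wz z0.
(* [F] fixes these preimages of truncations, so the net reaching [z] also shows that the extension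
   maps [z] to itself. *)
set D := [set v | range F v /\ exists n : nat, iota v = rmeet z n%:R].
have DF : F @` D = D.
  apply/seteqP; split=> [_ [v [[y _ <-] Dv] <-]|v [[y _ <-] Dv]].
    by rewrite (ce_projection Fe); split; [exists y|].
  by exists (F y); [split; [exists y|]|exact: (ce_projection Fe)].
have iD : iota @` D = range (fun n : nat => rmeet z n%:R).
  apply/seteqP; split=> [_ [v [_ [n vn]] <-]|_ [n _ <-]]; first by exists n.
  have [v Fv vn] := Wz n 0%N; exists v; last first.
    by rewrite vn /truncation oppr0 rjoin_l// le_rmeet z0 falg_natr_ge0.
  split=> //; exists n.
  by rewrite vn /truncation oppr0 rjoin_l// le_rmeet z0 falg_natr_ge0.
have Dz : supremums (iota @` D) z by rewrite iD; exact: supremums_rmeet_natr.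
have inc : increases_to iota D z.
  split=> //.
  - split.
      have : (iota @` D) (rmeet z 0%:R) by rewrite iD; exists 0%N.
      by move=> [v Dv _]; exists v.
    move=> u v [Fu [n un]] [Fv [m vm]].
    case: (leqP n m) => nm; [exists v|exists u]; split=> //.
    + by split=> //; exists m.
    + rewrite -uc_le un vm rmeet_mono// -riesz_subr_ge0 -natrB// falg_natr_ge0//.
    + by split=> //; exists n.
    + by rewrite -uc_le un vm rmeet_mono// -riesz_subr_ge0 -natrB ?falg_natr_ge0// ltnW.
  - by move=> v [_ [n vn]]; rewrite -uc_le linear0 vn le_rmeet z0 falg_natr_ge0.
split; first by exists D; rewrite DF.
by exists D; rewrite DF; split=> //; exists z; exact: Dz.1.
Qed.

Lemma ext_range_truncation_closure : ext_range iota F = W.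
Proof.
have Uc := (uc_complete Uiota).1; have Wc := truncation_closure_ocs Uc uc_range_ocl.
apply/seteqP; split=> [w [z _ [w1 [w2 [zw1 zw2 ->]]]]|w Ww].
  by apply: (ocsB Wc); [exact: ext_pos_closure zw1|exact: ext_pos_closure zw2].
have [] := closure_ext_pos Uc (ocs_rpos Wc Ww) (rpos_ge0 w).
have [] := closure_ext_pos Uc (ocs_rneg Wc Ww) (rneg_ge0 w).
move=> en Ln ep Lp; exists w => //.
by exists (rpos w), (rneg w); rewrite rposBneg.
Qed.

End ConditionalExpectation.

(** * Conditional bounds as genuine extrema, and domination in generated ideals *)

Section Bounds.
Context {R : realType} {U : fAlgebraType R}.
Hypothesis Uc : dedekind_complete U.
Implicit Types (x y f s : U) (A W : set U).

(** Completeness and nonemptiness ensure that [supremum 0 A] is not the default value 0 but a least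
    upper bound. *)
Lemma supremum_le A s : has_sup A ->
  (supremum 0 A <= s) <-> (forall g, A g -> g <= s).
Proof.
move=> hA; have [u l] : supremums A (supremum 0 A).
  rewrite /supremum; case: eqP hA => [->[/set0P]|_ hA]; first by rewrite eqxx.
  by apply: xgetPex; exact: Uc.
split=> [h g Ag|]; last exact: l.
by apply: le_trans h; exact: u.
Qed.

Lemma ge_infimum A s : has_inf A ->
  (s <= infimum 0 A) <-> (forall g, A g -> s <= g).
Proof.
move=> [A0 [l0 Al0]]; have [l g] : infimums A (infimum 0 A).
  rewrite /infimum; case: eqP A0 => [->/set0P|_ [a Aa]]; first by rewrite eqxx.
  apply: xgetPex; have [|t [ut lt]] := Uc (A := -%R @` A).
    split; first by exists (- a), a.
    by exists (- l0) => _ [b Ab <-]; rewrite riesz_leN2; exact: Al0.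
  exists (- t); split=> [b Ab|b bA].
    by rewrite riesz_leNl; apply: ut; exists b.
  by rewrite riesz_leNr; apply: lt => _ [c Ac <-]; rewrite riesz_leN2; exact: bA.
split=> [h b Ab|]; last exact: g.
by apply: le_trans h _; exact: l.
Qed.

Lemma rabsZ_le (a : R) x : rabs (a *: x) <= `|a| *: rabs x.
Proof.
rewrite rjoin_le -scaleNr; wlog a0 : a / 0 <= a => [H|].
  have [/H//|a0] := leP 0 a.
  by have := H (- a); rewrite normrN opprK andbC; apply; rewrite oppr_ge0 ltW.
by rewrite ger0_norm// scaleNr -scalerN !riesz_leZ// rjoin_ub.
Qed.

(** The elements whose modulus is dominated by some member of [W] already form an order ideal
    containing [W]. *)
Lemma smallest_order_ideal_ub W f : order_closed_space W ->
  smallest (@order_ideal R U) W f -> exists2 N, W N & f <= N.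
Proof.
move=> Wc; set J := [set f | exists2 N, W N & rabs f <= N].
have J0 : J 0.
  by exists 0; [exact: ocs0|rewrite rabs_le oppr0 lexx].
have Jid : order_ideal J.
  split; last by move=> x y [N WN yN] xy; exists N => //; exact: le_trans yN.
  split=> // a x y [N WN xN] [M WM yM]; exists (`|a| *: N + M).
    by apply: (ocsD Wc) => //; exact: (ocsZ Wc).
  have := le_trans (rabsZ_le a x) (riesz_leZ (normr_ge0 a) xN).
  move: yM; rewrite !rabs_le opprD => /andP[y1 y2] /andP[x1 x2].
  by rewrite !riesz_leD.
move=> /(_ J)[|N WN fN]; last first.
  by exists N => //; apply: le_trans fN; exact: (rjoin_ub _ _).1.
by split=> // x Wx; exists (rabs x); [exact: ocs_rabs|].
Qed.

End Bounds.

(** * The market: AIP against the one-period price bounds *)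

Theorem theorem29 (R : realType) (E : rieszType R) (U : fAlgebraType R)
    (iota : {linear E -> U}) (e : E) (T : nat) (F : nat -> {linear E -> E})
    (S : nat -> U)
    (E_complete : dedekind_complete E)
    (e_unit : weak_order_unit e)
    (U_completion : universal_completion iota)
    (iota_e : iota e = fone)
    (T_ge1 : (1 <= T)%N)
    (F_filtration : filtration e T F)
    (S_price : price_process iota T F S) :
  AIP iota T F S <->
  forall t : nat, (t < T)%N ->
    m_inf iota (F t) (S t.+1) <= S t <= M_sup iota (F t) (S t.+1).
Proof.
have Uc := (uc_complete U_completion).1.
pose W t := ext_range iota (F t).
have WE t : (t <= T)%N -> W t = truncation_closure (iota @` range (F t)).
  move=> tT; apply: (ext_range_truncation_closure E_complete U_completion iota_e).
  exact: (filtration_ce F_filtration).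
have Wc t : (t <= T)%N -> order_closed_space (W t).
  move=> tT; rewrite WE//; apply: (truncation_closure_ocs Uc).
  apply: (uc_range_ocl E_complete U_completion iota_e).
  exact: (filtration_ce F_filtration).
have WS i j : (i <= j <= T)%N -> W i `<=` W j.
  case/andP; rewrite leq_eqVlt => /orP[/eqP-> _//|ij jT].
  rewrite !WE// ?(leq_trans (ltnW ij))// => x Wx n m.
  (* By the tower property [F j] fixes the range of [F i], so each truncation transfers. *)
  have [_ [v _ <-] <-] := Wx n m; exists (F i v) => //; exists (F i v) => //.
  by have /(_ v)[_ ->] := filtration_tower F_filtration (introT andP (conj ij jT)).
have WSt t : (t <= T)%N -> W t (S t) := price_adapted S_price (t := t).
have Sb t : (t < T)%N -> exists2 N, W t N & S t.+1 <= N.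
  move=> tT; apply: (smallest_order_ideal_ub (Wc _ (ltnW tT))).
  exact: (price_Linfty S_price tT).
have boundsE t : (t < T)%N ->
    (m_inf iota (F t) (S t.+1) <= S t <= M_sup iota (F t) (S t.+1)) <->
    (forall g, W t g -> g <= S t.+1 -> g <= S t) /\
    (forall g, W t g -> S t.+1 <= g -> S t <= g).
  move=> tT; have [N WN SN] := Sb t tT.
  (* Nonnegativity of prices makes 0 an admissible lower bound. *)
  have hs : has_sup [set g | W t g /\ g <= S t.+1].
    split; last by exists (S t.+1) => g [].
    by exists 0; split; [exact: (ocs0 (Wc t (ltnW tT)))|exact: (price_ge0 S_price)].
  have hi : has_inf [set g | W t g /\ S t.+1 <= g].
    by split; [exists N|exists (S t.+1) => g []].
  split=> [/andP[/(supremum_le Uc _ hs) h1 /(ge_infimum Uc _ hi) h2]|[h1 h2]].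
    by split=> g Wg gS; [exact: h1|exact: h2].
  apply/andP; split; first by apply/(supremum_le Uc _ hs) => g []; exact: h1.
  by apply/(ge_infimum Uc _ hi) => g []; exact: h2.
split=> [aip t tT|bounds t tT].
  have Wt := Wc _ (ltnW tT); have WSt' := WSt _ (ltnW tT).
  (* The strategy holds [a] during the first period and nothing afterwards, starting from the price
     [- a ^+ 2 <= 0]. *)
  have noprofit a : W t a -> - a ^+ 2 + a * (S t.+1 - S t) >= 0 -> a = 0.
    move=> Wa ha; apply: (sqr_eq0 Uc); rewrite -(opprK (_ ^+ 2)) riesz_oppr_le0.
    suff : [set 0 : U] (- a ^+ 2) by move=> ->.
    have Wa2 : W t (- a ^+ 2) by apply/(ocsN Wt)/(ocsM Uc Wt).
    rewrite -(aip t tT); split; last by split=> //; rewrite riesz_oppr_le0 falg_sqr_ge0.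
    split=> //; exists (a * (S t.+1 - S t)) => //.
    exists (fun i => if i == t then a else 0).
      move=> i /andP[ti iT]; case: eqP => [->//|_].
      exact/(ocs0 (Wc _ (ltnW iT))).
    rewrite big_ltn//= eqxx big_nat_cond big1 ?addr0// => i /andP[/andP[ti _] _].
    have -> : (i.-1 == t) = false by case: i ti => // i ti; rewrite gtn_eqF.
    exact: mul0r.
  apply/(boundsE t tT); split=> g Wg gS.
    (* With [a] this positive part, [a^2 = a (g - S t) <= a (S t.+1 - S t)]. *)
    have a0 : rpos (g - S t) = 0.
      apply: noprofit; first exact/(ocs_rpos Wt)/(ocsB Wt).
      rewrite addrC riesz_subr_ge0 -mul_rpos [leRHS]mulrC falg_ler_wpM2r ?rpos_ge0//.
      by rewrite riesz_leD2.
    by rewrite -(riesz_leD2 (- S t)) subrr -a0; exact: (rjoin_ub _ _).1.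
  have a0 : - rpos (S t - g) = 0.
    apply: noprofit; first exact/(ocsN Wt)/(ocs_rpos Wt)/(ocsB Wt).
    rewrite addrC riesz_subr_ge0 sqrrN mulNr -mulrN opprB -mul_rpos.
    by rewrite [leRHS]mulrC falg_ler_wpM2r ?rpos_ge0// riesz_leD// riesz_leN2.
  rewrite -(riesz_leD2 (- g)) subrr -oppr0 -a0 opprK; exact: (rjoin_ub _ _).1.
(* Induction on the number of periods; membership of the accumulated value in [W (t + n)] lets
   [hedge_ge0] remove the last trade. *)
have hedge n (p : U) (th : nat -> U) : (t + n <= T)%N -> W t p ->
    (forall i, (t <= i < T)%N -> W i (th i)) ->
    W (t + n)%N (p + \sum_(t.+1 <= i < (t + n).+1) fmul (th i.-1) (increment S i)) /\
    (0 <= p + \sum_(t.+1 <= i < (t + n).+1) fmul (th i.-1) (increment S i) ->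
     0 <= p).
  move=> tnT Wp Wth; elim: n tnT => [|n IH].
    by rewrite addn0 big_geq// addr0.
  rewrite addnS => tnT; have [Wn pn] := IH (ltnW tnT).
  rewrite big_nat_recr/= ?ltnS ?leq_addr// addrA.
  have Wthn : W (t + n)%N (th (t + n)%N) by apply: Wth; rewrite leq_addr.
  have up : W (t + n)%N `<=` W (t + n).+1 by apply: WS; rewrite leqnSn.
  split.
    apply: (ocsD (Wc _ tnT)); first exact: up.
    apply: (ocsM Uc (Wc _ tnT)); first exact: up.
    by apply: (ocsB (Wc _ tnT)); [exact: WSt|apply/up/WSt/ltnW].
  move=> h; apply: pn.
  have [N WN SN] := Sb _ tnT; have [hl hu] := (boundsE _ tnT).1 (bounds _ tnT).
  apply: (hedge_ge0 Uc (Wc _ (ltnW tnT)) _ _ WN SN Wn Wthn h hl hu).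
    exact/WSt/ltnW.
  exact: (price_ge0 S_price).
apply/seteqP; split=> [p [[Wp [_ [th Wth ->] hp]] [_ p0]]|_ ->].
  apply: le_anti; rewrite p0 /=.
  have [|_] := hedge (T - t)%N p th _ Wp Wth; rewrite subnKC ?(ltnW tT)//.
  exact.
(* For the converse inclusion, the zero strategy super-hedges from the price 0. *)
have W0 i : (i <= T)%N -> W i 0 by move=> iT; exact: (ocs0 (Wc i iT)).
split; last by split=> //; exact/W0/ltnW.
split; first exact/W0/ltnW.
exists 0; last by rewrite addr0.
exists (fun=> 0); first by move=> i /andP[_ iT]; exact/W0/ltnW.
by rewrite big1// => i _; exact: mul0r.
Qed.
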